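(* Let $n\ge 3$ be an integer and $q$ a prime power. There is a basis $B$ of $C^0(\mathrm{Fl}_{n,q})$ such that the matrix representation of $\Delta_0^{+}(\mathrm{Fl}_{n,q})$ with respect to the basis $B$ is a block diagonal matrix with diagonal blocks $L_0,L_1,\ldots,L_{\lfloor n/2\rfloor}$ (in this order), where $$L_k= I_{\binom{n}{k}_q-\binom{n}{k-1}_q}\otimes \tilde{L}_k ,$$ $I_N$ is the $N\times N$ identity matrix, $\tilde{L}_0$ is the $(n-1)\times (n-1)$ matrix with entries, for $1\leq i,j\leq n-1$, $$(\tilde{L}_0)_{ij}=\begin{cases} n-2 & \text{ if } i=j,\\ -1 &\text{ if } i\neq j,\end{cases}$$ and, for $1\leq k\leq \lfloor n/2\rfloor$, $\tilde{L}_k$ is the $(n-2k+1)\times (n-2k+1)$ matrix with rows and columns indexed by $k\leq i,j\leq n-k$ and entries $$(\tilde{L}_k)_{ij}=\begin{cases} n-2 & \text{ if } i=j,\\ -c_{i j k} \binom{n-i}{j-i}_q^{-1} &\text{ if } i< j,\\ - \binom{i-k}{j-k}_q \binom{i}{j}_q^{-1} & \text{ if } i> j,\end{cases}$$ where $$c_{i j k}= \sum_{r=0}^k (-1)^{k-r} q^{\binom{r+1}{2}+\binom{k}{2}-rk}\binom{k}{r}_q \binom{n-i-k+r}{j-i-k+r}_q.$$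
   Context: A linear subspace of $\mathbb{F}_q^n$ is non-trivial if it is neither $\{0\}$ nor $\mathbb{F}_q^n$. A flag is a family of nested non-trivial subspaces $V_1\subsetneq\cdots\subsetneq V_k$; a complete flag is a flag of length $n-1$. $\mathrm{Fl}_{n,q}$ is the simplicial complex whose vertices are the non-trivial subspaces of $\mathbb{F}_q^n$ and whose simplices are the families of subspaces forming a flag. For a simplex $\sigma$, $w(\sigma)$ is the number of complete flags containing $\sigma$. $C^0(\mathrm{Fl}_{n,q})$ is the space of real functions on the vertices, and $C^1(\mathrm{Fl}_{n,q})$ the space of real skew-symmetric functions on ordered $1$-simplices. The coboundary operator $d_0:C^0\to C^1$ is $(d_0\phi)([U,V])=\phi(V)-\phi(U)$. For $k=0,1$ the space $C^k$ carries the inner product $\langle\phi,\psi\rangle=\sum_{\sigma} w(\sigma)\phi(\sigma)\psi(\sigma)$, summed over $k$-simplices $\sigma$ (each given one fixed order). $d_0^*$ is the adjoint of $d_0$ with respect to these inner products, and $\Delta_0^{+}(\mathrm{Fl}_{n,q})=d_0^*d_0: C^0\to C^0$ (the weighted upper $0$-Laplacian). $\binom{a}{b}_q$ denotes the number of $b$-dimensional subspaces of $\mathbb{F}_q^a$, and equals $0$ unless $a\ge b\ge 0$; binomials without the subscript $q$ are ordinary binomial coefficients. $\otimes$ is the Kronecker product, so $I_N\otimes \tilde L_k$ is the block diagonal matrix formed by $N$ copies of $\tilde{L}_k$. *)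

(* Defs.v *)
From HB Require Import structures.
From mathcomp Require Import all_boot all_order all_algebra.
From mathcomp Require Import mxtens.
From mathcomp Require Import boolp reals.

Set Implicit Arguments.
Unset Strict Implicit.
Unset Printing Implicit Defensive.

Import Order.TTheory GRing.Theory Num.Theory.

Local Open Scope ring_scope.

Section FiniteVspace.
Import VectorInternalTheory.
HB.instance Definition _ (F : finFieldType) (vT : vectType F) :=
  [Countable of {vspace vT} by <:].
HB.instance Definition _ (F : finFieldType) (vT : vectType F) :=
  [Finite of {vspace vT} by <:].
End FiniteVspace.

Section FlagComplex.

Variables (F : finFieldType) (n : nat).

Definition nontrivial_subspace (U : {vspace 'rV[F]_n}) : bool :=
  (U != 0%VS) && (U != fullv).

Definition vertex : Type := {U : {vspace 'rV[F]_n} | nontrivial_subspace U}.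
HB.instance Definition _ := Finite.on vertex.

Definition vsub (U V : vertex) : bool := (val U <= val V)%VS.
Definition vproper (U V : vertex) : bool := (U != V) && vsub U V.

(* A family of subspaces is nested when it is totally ordered by inclusion;
   its members are pairwise distinct, being given as a set. *)
Definition is_flag (s : {set vertex}) : bool :=
  [forall U in s, forall V in s, vsub U V || vsub V U].

Definition complete_flag (s : {set vertex}) : bool :=
  is_flag s && (#|s| == n.-1).

Definition weight (s : {set vertex}) : nat :=
  #|[set f : {set vertex} | complete_flag f & s \subset f]|.

Definition is_edge (e : vertex * vertex) : bool :=
  (e.1 != e.2) && is_flag [set e.1; e.2].

Definition edge : Type := {e : vertex * vertex | is_edge e}.
HB.instance Definition _ := Finite.on edge.

Definition src (e : edge) : vertex := (val e).1.
Definition tgt (e : edge) : vertex := (val e).2.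

Fact is_edge_swap (e : edge) : is_edge (tgt e, src e).
Proof.
by rewrite /is_edge /= eq_sym setUC; exact: (valP e).
Qed.

Definition flip (e : edge) : edge := exist _ (tgt e, src e) (is_edge_swap e).

Lemma weight1_gt0 (U : vertex) : (0 < weight [set U])%N.
Proof.
have /andP[U0 UT] := valP U.
pose X := vbasis (val U) ++ vbasis ((val U)^C)%VS.
have bX : basis_of fullv X.
  rewrite -(addv_complf (val U)); apply: cat_basis; try exact: vbasisP.
  by apply/directv_addP; exact: capv_compl.
have dT : \dim (fullv : {vspace 'rV[F]_n}) = n by rewrite dimvf /dim /= mul1n.
have sX : size X = n.
  by apply: etrans dT; rewrite -(span_basis bX); apply/esym/eqP/(basis_free bX).
have dP i : (i <= n)%N -> \dim <<take i X>> = i.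
  move=> le_in; have := basis_free bX; rewrite -{1}(cat_take_drop i X).
  by move=> /catl_free /eqP ->; rewrite size_takel ?sX.
have lt_ord (i : 'I_n.-1) : (i.+1 < n)%N by rewrite -ltn_predRL.
have ntP (i : 'I_n.-1) : nontrivial_subspace <<take i.+1 X>>%VS.
  have dPi := dP _ (ltnW (lt_ord i)).
  rewrite /nontrivial_subspace -dimv_eq0 dPi /=; apply/eqP => eqT.
  by have := lt_ord i; rewrite -{1}dPi eqT dT ltnn.
pose g (i : 'I_n.-1) : vertex := exist _ <<take i.+1 X>>%VS (ntP i).
have subP i j : (i <= j)%N -> (<<take i X>> <= <<take j X>>)%VS.
  move=> le_ij; apply/sub_span => x.
  by rewrite -(take_takel X le_ij) => /mem_take.
have g_inj : injective g.
  move=> i j /(congr1 val)/(congr1 (fun W => \dim W)) /=.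
  by rewrite !dP ?(ltnW (lt_ord _))// => -[] /val_inj.
have gU : U \in [set g i | i : 'I_n.-1].
  have dU0 : (0 < \dim (val U))%N by rewrite lt0n dimv_eq0.
  have dUT : (\dim (val U) < n)%N.
    apply: leq_trans (eq_leq dT); rewrite ltn_neqAle dimvS ?subvf// andbT.
    by apply: contraNneq UT => eqU; rewrite eqEdim subvf eqU /=.
  have lt_d : ((\dim (val U)).-1 < n.-1)%N by rewrite ltn_predRL prednK.
  apply/imsetP; exists (Ordinal lt_d) => //; apply/val_inj => /=.
  rewrite prednK// take_size_cat ?size_tuple//.
  by rewrite (span_basis (vbasisP _)).
rewrite /weight card_gt0; apply/set0Pn; exists [set g i | i : 'I_n.-1].
rewrite inE sub1set gU andbT /complete_flag card_imset// card_ord eqxx andbT.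
apply/forall_inP => _ /imsetP[i _ ->]; apply/forall_inP => _ /imsetP[j _ ->].
by apply/orP; case: (leqP i j) => [le_ij|/ltnW le_ji]; [left|right]; apply: subP.
Qed.

Variable R : realType.

Definition cochain0 : Type := {ffun vertex -> R^o}.
HB.instance Definition _ := Vector.on cochain0.

Definition skew : {pred {ffun edge -> R^o}} :=
  fun f => [forall e, f (flip e) == - f e].

Fact skew_submod_closed : submod_closed skew.
Proof.
split=> [|a f g /forallP hf /forallP hg]; apply/forallP => e; rewrite !ffunE.
  by rewrite oppr0.
by rewrite (eqP (hf e)) (eqP (hg e)) scalerN opprD.
Qed.

HB.instance Definition _ :=
  GRing.isSubmodClosed.Build R {ffun edge -> R^o} skew skew_submod_closed.

Record cochain1 : Type :=
  Cochain1 { cochain1_fun :> {ffun edge -> R^o}; _ : cochain1_fun \in skew }.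

HB.instance Definition _ := [isSub for cochain1_fun].
HB.instance Definition _ := [Choice of cochain1 by <:].
HB.instance Definition _ := [SubChoice_isSubLmodule of cochain1 by <:].

Definition inner0 (phi psi : cochain0) : R :=
  \sum_(U : vertex) (weight [set U])%:R * phi U * psi U.

(* Each 1-simplex {U, V} is listed once, in the order U < V. *)
Definition inner1 (phi psi : cochain1) : R :=
  \sum_(e : edge | vproper (src e) (tgt e))
    (weight [set src e; tgt e])%:R * phi e * psi e.

Fact d0_skew (phi : cochain0) :
  [ffun e : edge => (phi (tgt e) - phi (src e) : R^o)] \in skew.
Proof. by apply/forallP => e; rewrite !ffunE opprB. Qed.

Definition d0 (phi : cochain0) : cochain1 := Cochain1 (d0_skew phi).

Fact d0_linear : linear d0.
Proof.
move=> a f g; apply/val_inj/ffunP => e; rewrite /= !ffunE.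
by rewrite scalerBr opprD addrACA.
Qed.

HB.instance Definition _ :=
  GRing.isLinear.Build R cochain0 cochain1 *:%R d0 d0_linear.

Definition is_adjoint (f : cochain0 -> cochain1) (g : cochain1 -> cochain0) :=
  forall phi psi, inner1 (f phi) psi = inner0 phi (g psi).

Fact d0_adjoint_exists :
  exists g : {linear cochain1 -> cochain0}, is_adjoint d0 g.
Proof.
pose w (e : edge) : R := (weight [set src e; tgt e])%:R.
pose g (psi : cochain1) : cochain0 := [ffun U =>
  (\sum_(e : edge | tgt e == U) (weight [set U])%:R^-1 * w e * psi e : R^o)].
have g_lin : linear g.
  move=> a f h; apply/ffunP => U; rewrite !ffunE scaler_sumr -big_split /=.
  apply: eq_bigr => e _; rewrite !ffunE /= mulrDr; congr (_ + _).
  by rewrite /GRing.scale /= mulrCA.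
pose gl := GRing.isLinear.Build R cochain1 cochain0 *:%R g g_lin.
pose G : {linear cochain1 -> cochain0} := HB.pack g gl.
exists G => phi psi.
rewrite /inner0 /inner1 /=.
have -> : \sum_U (weight [set U])%:R * phi U * g psi U =
    \sum_(e : edge) w e * (phi (tgt e) * psi e).
  rewrite [RHS](partition_big tgt xpredT)//=; apply: eq_bigr => U _.
  rewrite ffunE mulr_sumr; apply: eq_bigr => e /eqP ->.
  rewrite mulrAC !mulrA divff ?mul1r; last first.
    by rewrite pnatr_eq0 -lt0n weight1_gt0.
  by rewrite mulrAC [_ * phi U]mulrC -!mulrA mulrCA.
have flipK : involutive flip by move=> e; apply/val_inj; case: e => -[].
rewrite [RHS](bigID (fun e => vproper (src e) (tgt e))) /=.
rewrite [X in _ = _ + X](reindex_inj (inv_inj flipK)) /=.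
rewrite [X in _ = _ + X](eq_bigl (fun e => vproper (src e) (tgt e))); last first.
  move=> e; rewrite -[src (flip e)]/(tgt e) -[tgt (flip e)]/(src e) /vproper.
  have /andP[/= ne /forall_inP fl] := valP e.
  have {fl}/forall_inP/(_ (tgt e)) := fl (src e) (set21 _ _).
  rewrite set22 => /(_ isT) cmp.
  rewrite eq_sym /src /tgt ne /= -/(src e) -/(tgt e).
  case/boolP: (vsub (src e) (tgt e)) cmp => [ab _|_ /= ->//].
  apply: contraNN ne => ba; apply/eqP/val_inj/eqP.
  by rewrite eqEsubv; apply/andP.
rewrite -big_split /=; apply: eq_bigr => e _.
rewrite ffunE /w -[src (flip e)]/(tgt e) -[tgt (flip e)]/(src e) setUC.
have /forallP/(_ e)/eqP -> : cochain1_fun psi \in skew by case: psi.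
by rewrite !mulrN -mulrBr -mulrBl mulrA.
Qed.

Definition d0_adj : {linear cochain1 -> cochain0} :=
  projT1 (cid d0_adjoint_exists).

Lemma d0_adjP : is_adjoint d0 d0_adj.
Proof. exact: projT2 (cid d0_adjoint_exists). Qed.

Lemma d0_adj_unique (g : cochain1 -> cochain0) :
  is_adjoint d0 g -> g =1 d0_adj.
Proof.
move=> gP psi; apply/ffunP => U; pose delta : cochain0 := [ffun V => (V == U)%:R : R^o].
have innerE (phi : cochain0) : inner0 delta phi = (weight [set U])%:R * phi U.
  rewrite /inner0 (bigD1 U)//= ffunE eqxx mulr1 big1 ?addr0// => V /negbTE VU.
  by rewrite ffunE VU mulr0 mul0r.
have := gP delta psi; rewrite d0_adjP !innerE => /mulfI ->//.
by rewrite pnatr_eq0 -lt0n weight1_gt0.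
Qed.

Definition upper_laplacian0 : {linear cochain0 -> cochain0} := d0_adj \o d0.

End FlagComplex.

(* The column convention: T (B_j) = \sum_i (matrix_rep B T) i j *: B_i. *)
Definition matrix_rep (K : fieldType) (V : vectType K) (m : nat)
    (B : m.-tuple V) (T : V -> V) : 'M[K]_m :=
  \matrix_(i, j) coord B i (T (tnth B j)).

Section Blocks.

Variables (R : realType) (F : finFieldType) (n : nat).

(* The arguments are integers because negative ones occur, giving 0. *)
Definition qbinom (a b : int) : nat :=
  match a, b with
  | Posz a, Posz b => #|[set U : {vspace 'rV[F]_a} | \dim U == b]|
  | _, _ => 0
  end.

Definition cijk (i j k : nat) : R :=
  \sum_(r < k.+1)
    (-1) ^+ (k - r) * #|F|%:R ^ ('C(r.+1, 2)%:Z + 'C(k, 2)%:Z - (r * k)%:Z)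
    * (qbinom k r)%:R
    * (qbinom (n%:Z - i%:Z - k%:Z + r%:Z) (j%:Z - i%:Z - k%:Z + r%:Z))%:R.

Definition Ltilde_entry (k i j : nat) : R :=
  if i == j then n%:R - 2
  else if (i < j)%N then - cijk i j k / (qbinom (n%:Z - i%:Z) (j%:Z - i%:Z))%:R
  else - (qbinom (i%:Z - k%:Z) (j%:Z - k%:Z))%:R / (qbinom i j)%:R.

Definition Ltilde_size (k : nat) : nat :=
  if k is 0 then n.-1 else (n - k.*2).+1.

(* For 0 < k the rows and columns are indexed by k, ..., n - k: the ordinal i
   stands for the index k + i. *)
Definition Ltilde (k : nat) : 'M[R]_(Ltilde_size k) :=
  match k with
  | 0 => \matrix_(i, j) (if i == j then n%:R - 2 else - 1)
  | k'.+1 => \matrix_(i, j) Ltilde_entry k'.+1 (k'.+1 + i) (k'.+1 + j)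
  end.

Definition multiplicity (k : nat) : nat :=
  qbinom n k - qbinom n (k%:Z - 1).

Definition Lblock (k : nat) : 'M[R]_(multiplicity k * Ltilde_size k) :=
  (1%:M : 'M[R]_(multiplicity k)) *t Ltilde k.

End Blocks.

(* Main.v *)
Require Import Defs.
From HB Require Import structures.
From mathcomp Require Import all_boot all_order all_algebra finfield.
From mathcomp Require Import zify ring.
From mathcomp Require Import mxtens.
From mathcomp Require Import boolp reals.

(** The complex of flags is graded by dimension.  A complete flag through [U]
contains exactly one subspace of each dimension [j], and by transitivity of
GL_n on chains of given dimensions all subspaces of dimension [j] comparable
with [U] are met equally often.  Hence the value at [U] of the upper Laplacian
of [phi] is [(n - 2) * phi U] minus, for every [j] other than [\dim U], the
average of [phi] over the subspaces of dimension [j] comparable with [U]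
([laplacian_level]).

Call a function [f] on the subspaces of dimension [k] harmonic when its sum
over the [W] above any fixed smaller subspace vanishes.  From [f] one builds
on each level [j] the function [lift k f], summing [f] over the [W] of
dimension [k] inside a given subspace.  Averaging a lift downwards or upwards
gives a multiple of the lift of the same [f] ([lift_down], [lift_up]).  Going
down this is a direct double count.  Going up, the sum is grouped by
[r = \dim (W :&: X)], and Moebius inversion in the subspace lattice shows that
for harmonic [f] each of these groups is a fixed multiple of [lift k f X]
([meet_sum_harmonic]).  So the lifts of one harmonic [f] span an invariant
subspace on which the Laplacian acts by [Ltilde k]; lifts outside the levels
[k, ..., n - k] vanish.

By rank-nullity there are at least [multiplicity F n k] independent harmonic
functions for each [k] ([harmonic_family]).  Lifts of independent harmonic
functions, for all [k] together, stay independent: pushing a vanishing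
combination down to level [k] kills the lifts coming from larger dimensions
and multiplies those coming from [k] itself by the nonzero number
[up_coef k k j], so that the coefficients vanish by induction on [k]
([lifts_independent]).  Summing the telescoping multiplicities over all levels
then gives at least as many lifts as there are vertices, so they form a basis.

Both the inversion and the nonvanishing rest on one closed form for an
alternating sum of Gaussian binomials ([alt_gauss_closed]). *)

Set Implicit Arguments.
Unset Strict Implicit.
Unset Printing Implicit Defensive.

Import Order.TTheory GRing.Theory Num.Theory.
Local Open Scope ring_scope.

(** * Counting subspaces in an interval *)

Section Counting.
Variable F : finFieldType.
Local Notation q := #|F|.

Lemma q_gt1 : (1 < q)%N. Proof. exact: finNzRing_gt1. Qed.

(** The q-factorial with every factor multiplied by [q - 1], so that no division
is needed. *)
Definition qfact (a : nat) : nat := \prod_(i < a) (q ^ i.+1 - 1)%N.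

Lemma qfactS a : qfact a.+1 = (qfact a * (q ^ a.+1 - 1))%N.
Proof. by rewrite /qfact big_ord_recr. Qed.

Lemma qfact_gt0 a : (0 < qfact a)%N.
Proof.
by apply: prodn_gt0 => i; rewrite subn_gt0 -[1%N](exp1n i.+1) ltn_exp2r ?q_gt1.
Qed.

Lemma qfact_falling a m : (m <= a)%N ->
  (\prod_(i < m) (q ^ (a - i) - 1) * qfact (a - m) = qfact a)%N.
Proof.
elim: m => [|m IH] lt_ma; first by rewrite big_ord0 mul1n subn0.
rewrite big_ord_recr /= -[RHS](IH (ltnW lt_ma)) -mulnA; congr (_ * _)%N.
by rewrite -(subnSK lt_ma) qfactS mulnC.
Qed.

Section Extension.
Variable N : nat.
Local Notation V := 'rV[F]_N.
Implicit Types (X Y W : {vspace V}) (v : V).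

(** The tuples of vectors of [W] that are linearly independent modulo [X].
Subspaces between [X] and [W] are counted by counting such tuples twice. *)
Definition extends X W m (t : m.-tuple V) : bool :=
  all (mem W) t && (\dim (X + <<t>>) == \dim X + m)%N.

Lemma dim_add_line X v : \dim (X + <[v]>) = (\dim X + (v \notin X))%N.
Proof.
case: (boolP (v \in X)) => vX /=.
  by rewrite addn0; congr (\dim _); apply/addv_idPl; rewrite -memvE.
have := dimv_sum_cap X <[v]>.
have -> : (X :&: <[v]> = 0)%VS.
  apply/eqP; rewrite -subv0; apply/subvP => u; rewrite memv_cap memv0.
  case/andP=> uX /vlineP[c def_u]; apply: contraR vX => u0.
  have c0 : c != 0 by apply: contraNneq u0 => c0; rewrite def_u c0 scale0r.
  by rewrite -[v](scalerK c0) -def_u memvZ.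
rewrite dimv0 addn0 dim_vline => ->; suff -> : v != 0 by [].
by apply: contraNneq vX => ->; rewrite mem0v.
Qed.

Lemma extends_cons X W m v (t : m.-tuple V) :
  extends X W [tuple of v :: t] =
    [&& v \in W, v \notin X & extends (X + <[v]>) W t].
Proof.
rewrite /extends /= span_cons addvA dim_add_line.
case vW: (v \in W) => //=; case: (boolP (v \in X)) => vX /=; last first.
  by rewrite addn1 addSnnS.
apply/negbTE; rewrite negb_and; apply/orP; right; apply: contraTneq (leqnn m) => e.
have : (\dim (X + <[v]> + <<t>>) <= \dim X + m)%N.
  apply: (leq_trans (dimv_add_leqif _ _)).
  by rewrite dim_add_line vX addn0 leq_add2l -{2}(size_tuple t) dim_span.
by rewrite e; lia.
Qed.

(** Each vector is chosen in [W] outside the span of [X] and of the vectors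
already chosen. *)
Lemma card_extends X W m : (X <= W)%VS ->
  #|[set t : m.-tuple V | extends X W t]|
    = (\prod_(i < m) (q ^ \dim W - q ^ (\dim X + i)))%N.
Proof.
elim: m X => [|m IH] X sXW.
  rewrite big_ord0 (_ : [set t | _] = [set [tuple]]) ?cards1//.
  apply/setP => t; rewrite !inE tuple0 /extends /= span_nil addv0 addn0 !eqxx.
  by [].
rewrite -sum1_card.
rewrite (reindex (fun p : V * m.-tuple V => [tuple of p.1 :: p.2])); last first.
  exists (fun t => (thead t, [tuple of behead t])) => [[v t] _|t _] /=.
    by congr (_, _); apply/val_inj.
  by rewrite -tuple_eta.
rewrite (eq_bigl (fun p => ((p.1 \in W) && (p.1 \notin X)) &&
    (p.2 \in [set t | extends (X + <[p.1]>) W t]))); last first.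
  by case=> v t; rewrite inE extends_cons inE -andbA.
rewrite -(pair_big_dep (fun v => (v \in W) && (v \notin X))
   (fun v t => t \in [set t | extends (X + <[v]>) W t]) (fun _ _ => 1%N)) /=.
rewrite (eq_bigr (fun=> \prod_(i < m) (q ^ \dim W - q ^ (\dim X + i.+1))%N)).
  rewrite sum_nat_const big_ord_recl addn0; congr (_ * _)%N.
  rewrite -!card_vspace.
  have <- : #|[predD W & X]| = (#|W| - #|X|)%N.
    rewrite -(cardID (mem X) (mem W)) (_ : #|[predI W & X]| = #|X|) ?addKn//.
    apply: eq_card => x; rewrite !inE.
    by case: (boolP (x \in X)) => xX; rewrite ?andbF// (subvP sXW).
  by apply: eq_card => x; rewrite !inE andbC.
move=> v /andP[vW vX]; rewrite sum1_card IH; last by rewrite subv_add sXW.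
by apply: eq_bigr => i _; rewrite dim_add_line vX addn1 addSnnS.
Qed.

Definition interval X W j : {set {vspace V}} :=
  [set Y | [&& (X <= Y)%VS, (Y <= W)%VS & \dim Y == j]].

(** A tuple independent modulo [X] determines the space [Y] that it spans with
[X], and the tuples determining a given [Y] are those of full length in [Y]. *)
Lemma card_interval_prod X W m : (X <= W)%VS ->
  (#|interval X W (\dim X + m)| *
     \prod_(i < m) (q ^ (\dim X + m) - q ^ (\dim X + i))
   = \prod_(i < m) (q ^ \dim W - q ^ (\dim X + i)))%N.
Proof.
move=> sXW; rewrite -[RHS](card_extends m sXW) -sum_nat_const.
rewrite -[RHS]sum1_card.
rewrite (partition_big (fun t : m.-tuple V => (X + <<t>>)%VS)
   (fun Y => Y \in interval X W (\dim X + m))) /=; last first.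
  move=> t; rewrite inE => /andP[/allP tW /eqP dt].
  by rewrite inE addvSl dt eqxx andbT subv_add sXW; apply/span_subvP.
apply: eq_bigr => Y; rewrite inE => /and3P[sXY sYW /eqP dY].
rewrite -[in LHS]dY -card_extends // -sum1_card; apply: eq_bigl => t.
rewrite !inE /extends -dY; apply/idP/idP.
  case/andP=> tY /eqP dt.
  have sub : (X + <<t>> <= Y)%VS.
    by rewrite subv_add sXY; apply/span_subvP => x xt; apply: (allP tY).
  rewrite eqEdim sub dt dY leqnn eqxx !andbT.
  by apply/allP => x /(allP tY) /(subvP sYW).
case/andP=> /andP[tW dt] /eqP eY; rewrite dt andbT.
apply/allP => x xt; rewrite inE -eY; apply: (subvP (addvSr _ _)).
exact: memv_span.
Qed.

Lemma card_interval X W j : (X <= W)%VS -> (\dim X <= j <= \dim W)%N ->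
  (#|interval X W j| * (qfact (j - \dim X) * qfact (\dim W - j))
     = qfact (\dim W - \dim X))%N.
Proof.
move=> sXW /andP[]; set d := \dim X; set w := \dim W.
move=> /subnKC; set m := (j - d)%N => <- le_w.
have prodE a : (d + m <= a)%N ->
    (\prod_(i < m) (q ^ a - q ^ (d + i))
     = \prod_(i < m) q ^ (d + i) * \prod_(i < m) (q ^ (a - d - i) - 1))%N.
  move=> le_a; rewrite -big_split /=; apply: eq_bigr => i _.
  rewrite mulnBr muln1 -expnD; congr (_ ^ _ - _)%N.
  by have := ltn_ord i; lia.
have := card_interval_prod m sXW; rewrite -/d -/w !prodE // mulnCA => /eqP.
rewrite eqn_pmul2l ?prodn_gt0// => [/eqP|i]; last first.
  by rewrite expn_gt0 (ltnW q_gt1).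
rewrite addKn => e; have le_m : (m <= w - d)%N by lia.
rewrite -(qfact_falling le_m) -e mulnA subnDA; congr (_ * _ * _)%N.
by have := qfact_falling (leqnn m); rewrite subnn /qfact big_ord0 muln1 => ->.
Qed.

Lemma card_interval0 X W j : ~~ (\dim X <= j <= \dim W)%N ->
  #|interval X W j| = 0%N.
Proof.
move=> out; apply/eqP; rewrite cards_eq0; apply/eqP/setP => Y; rewrite !inE.
by apply: contraNF out => /and3P[/dimvS dXY /dimvS dYW /eqP <-]; rewrite dXY.
Qed.

End Extension.

Definition gauss (a b : nat) : nat := qbinom F a b.

Lemma gaussE a b : gauss a b = #|interval (0 : {vspace 'rV[F]_a}) fullv b|.
Proof. by apply: eq_card => U; rewrite !inE sub0v subvf. Qed.

Lemma dim_fullv a : \dim (fullv : {vspace 'rV[F]_a}) = a.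
Proof. by rewrite dimvf /dim /= mul1n. Qed.

Lemma gauss_small a b : (a < b)%N -> gauss a b = 0%N.
Proof.
by move=> lt_ab; rewrite gaussE card_interval0// dimv0 dim_fullv /= -ltnNge.
Qed.

Lemma gauss_fact a b : (b <= a)%N ->
  (gauss a b * (qfact b * qfact (a - b)) = qfact a)%N.
Proof.
move=> le_ba; have := @card_interval a 0 fullv b (sub0v _).
by rewrite -gaussE dim_fullv dimv0 !subn0 => ->.
Qed.

Lemma gauss_gt0 a b : (b <= a)%N -> (0 < gauss a b)%N.
Proof.
by move=> /gauss_fact; have := qfact_gt0 a; case: gauss => // + e; rewrite -e.
Qed.

Lemma gauss_unique a b c : (b <= a)%N ->
  (c * (qfact b * qfact (a - b)) = qfact a)%N -> c = gauss a b.
Proof.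
move=> le_ba e; apply/eqP.
by rewrite -(@eqn_pmul2r (qfact b * qfact (a - b))) ?muln_gt0 ?qfact_gt0// e gauss_fact.
Qed.

Lemma gauss0 a : gauss a 0 = 1%N.
Proof.
by apply/esym/gauss_unique; rewrite // subn0 mul1n /qfact big_ord0 mul1n.
Qed.

Lemma gauss_sym a b : (b <= a)%N -> gauss a (a - b) = gauss a b.
Proof.
move=> le_ba; apply: gauss_unique => //.
by rewrite -[RHS](gauss_fact (leq_subr b a)) subKn // [(qfact b * _)%N]mulnC.
Qed.

Lemma gaussn a : gauss a a = 1%N.
Proof. by rewrite -[X in gauss _ X]subn0 gauss_sym // gauss0. Qed.

Lemma card_interval_gauss N (X W : {vspace 'rV[F]_N}) j :
  (X <= W)%VS -> (\dim X <= j)%N ->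
  #|interval X W j| = gauss (\dim W - \dim X) (j - \dim X).
Proof.
move=> sXW le_j; case: (leqP j (\dim W)) => le_W; last first.
  rewrite card_interval0; last by rewrite negb_and -!ltnNge le_W orbT.
  by rewrite gauss_small //; have := dimvS sXW; lia.
apply: gauss_unique; first lia.
by rewrite -(card_interval sXW (j := j)) ?le_j// -subnDA addnBA// addKn.
Qed.

(** Counting by codimension covers every [j <= \dim W] at once, including the
empty intervals where [j < \dim X], in which a truncated [j - \dim X] would be
wrong. *)
Lemma card_interval_gauss_sym N (X W : {vspace 'rV[F]_N}) j :
  (X <= W)%VS -> (j <= \dim W)%N ->
  #|interval X W j| = gauss (\dim W - \dim X) (\dim W - j).
Proof.
move=> sXW le_W; case: (leqP (\dim X) j) => le_j.
  rewrite card_interval_gauss // -gauss_sym; last lia.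
  by congr gauss; have := dimvS sXW; lia.
rewrite card_interval0; last by rewrite negb_and -!ltnNge le_j.
by rewrite gauss_small //; have := dimvS sXW; lia.
Qed.

Lemma gauss_pascal_l a b :
  gauss a.+1 b.+1 = (gauss a b + q ^ b.+1 * gauss a b.+1)%N.
Proof.
case: (ltngtP b a) => [lt_ba|lt_ab|->]; last first.
- by rewrite !gaussn gauss_small // muln0.
- by rewrite !gauss_small //; lia.
apply/esym/gauss_unique; first lia.
rewrite subSS -[(a - b)%N](subnSK lt_ba) mulnDl.
have e1 := gauss_fact (ltnW lt_ba); have e2 := gauss_fact lt_ba.
rewrite -(subnSK lt_ba) in e1.
transitivity (qfact a * (q ^ b.+1 - 1)
              + q ^ b.+1 * (qfact a * (q ^ (a - b.+1).+1 - 1)))%N.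
  congr (_ + _)%N; [rewrite -{}e1 | rewrite -{}e2]; rewrite !qfactS; ring.
rewrite qfactS mulnCA -mulnDr; congr (_ * _)%N; rewrite mulnBr -expnD muln1.
have -> : (b.+1 + (a - b.+1).+1 = a.+1)%N by lia.
have : (0 < q ^ b.+1)%N by rewrite expn_gt0 (ltnW q_gt1).
have : (q ^ b.+1 <= q ^ a.+1)%N by rewrite leq_exp2l ?q_gt1//; lia.
lia.
Qed.

Lemma gauss_pascal_r a b : (b <= a)%N ->
  gauss a.+1 b.+1 = (gauss a b.+1 + q ^ (a - b) * gauss a b)%N.
Proof.
rewrite leq_eqVlt => /predU1P[->|lt_ba].
  by rewrite !gaussn gauss_small// subnn.
rewrite -gauss_sym; last lia.
rewrite subSS -(subnSK lt_ba) gauss_pascal_l -(gauss_sym (b := b.+1)) //.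
by rewrite subnSK // (gauss_sym (b := b)) // ltnW.
Qed.

End Counting.

(** * An alternating sum of Gaussian binomials *)

Section AlternatingSum.
Variables (F : finFieldType) (R : comPzRingType).
Local Notation q := #|F|.

(** The Moebius function of an interval of length [m] in the lattice of
subspaces. *)
Definition mobius (m : nat) : R := (-1) ^+ m * q%:R ^+ 'C(m, 2).

Definition alt_gauss (k a t : nat) : R :=
  \sum_(r < k.+1) mobius (k - r) * (gauss F k r)%:R * (gauss F (a + r) t)%:R.

Lemma mobiusS m : mobius m.+1 = - (q%:R ^+ m * mobius m).
Proof. by rewrite /mobius exprS binS bin1 addnC exprD; ring. Qed.

(** Pascal's rule for [gauss k.+1 r]; the sign change and the factor [q ^ k]
come from [mobiusS] and [r + (k - r) = k]. *)
Lemma alt_gaussS k a t :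
  alt_gauss k.+1 a t = alt_gauss k a.+1 t - q%:R ^+ k * alt_gauss k a t.
Proof.
(* [T r] collects the second terms of Pascal's rule, with the term of
   index 0 in place of the missing one. *)
pose T r := q%:R ^+ r * mobius (k.+1 - r) * (gauss F k r)%:R * (gauss F (a + r) t)%:R.
have -> : - (q%:R ^+ k * alt_gauss k a t) = \sum_(r < k.+2) T r.
  rewrite big_ord_recr /= {2}/T gauss_small // mulr0 mul0r addr0 mulr_sumr -sumrN.
  apply: eq_bigr => r _; rewrite /T subSn -1?ltnS // mobiusS.
  by have {1}-> : k = (r + (k - r))%N; [have := ltn_ord r; lia | rewrite exprD; ring].
rewrite /alt_gauss [LHS]big_ord_recl [X in _ = _ + X]big_ord_recl.
rewrite /T /= expr0 mul1r !gauss0 addrCA; congr (_ + _).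
rewrite -big_split /=; apply: eq_bigr => r _.
by rewrite /bump /= !add1n gauss_pascal_l subSS natrD natrM natrX addSnnS; ring.
Qed.

(** The [k]-th q-difference of [gauss] in its upper argument, as [alt_gaussS]
applied to the closed form is again Pascal's rule.  For [a = 0] and [t < k] it
is Moebius inversion; for [k <= t] and [t - k <= a] it is a power of [q] times a
positive integer, hence nonzero in characteristic zero. *)
Lemma alt_gauss_closed k a t :
  alt_gauss k a t =
    if (k <= t)%N then q%:R ^+ (k * (a - (t - k))) * (gauss F a (t - k))%:R else 0.
Proof.
elim: k a t => [|k IH] a t.
  by rewrite /alt_gauss big_ord1 /mobius gauss0 bin0n !expr0 addn0 !subn0 !mul1r.
rewrite alt_gaussS !IH; case: (ltngtP k t) => [lt_kt|_|<-].
- have -> : (t - k = (t - k.+1).+1)%N by lia.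
  move: (t - k.+1)%N => u.
  case: (ltngtP a u) => [lt_au|lt_ua|->].
  + by rewrite !gauss_small ?mulr0 ?subr0 //; lia.
  + rewrite gauss_pascal_r ?(ltnW lt_ua)// subSS natrD natrM natrX.
    have -> : (a - u = (a - u.+1).+1)%N by lia.
    by rewrite mulSn !mulnS !exprD; ring.
  + by rewrite !gaussn gauss_small // !subnn !muln0 mulr0n !mulr0 subr0.
- by rewrite mulr0 subr0.
- by rewrite subnn !subn0 !gauss0 mulnS exprD !mulr1 subrr.
Qed.

End AlternatingSum.

(** * Harmonic functions and their lifts *)

Section Harmonic.
Variables (F : finFieldType) (n : nat) (R : numFieldType).
Local Notation q := #|F|.
Local Notation space := {vspace 'rV[F]_n}.
Local Notation mobius := (mobius F R).
Implicit Types (f : space -> R) (U V W X : space).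

(** Taking [f] on all subspaces and selecting the dimension inside each sum
spares a type of subspaces for every dimension. *)
Definition harmonic k f :=
  forall X, (\dim X < k)%N -> \sum_(W | (\dim W == k) && (X <= W)%VS) f W = 0.

Definition lift k f U : R := \sum_(W | (\dim W == k) && (W <= U)%VS) f W.

Definition meet_sum k f r X : R :=
  \sum_(W | (\dim W == k) && (\dim (W :&: X) == r)) f W.

Lemma double_count (P Q : pred space) (r : rel space) f :
  \sum_(V | P V) \sum_(W | Q W && r W V) f W =
  \sum_(W | Q W) f W * #|[set V | P V && r W V]|%:R.
Proof.
rewrite (exchange_big_dep Q) /=; last by move=> V W _ /andP[].
apply: eq_bigr => W QW; rewrite mulr_natr -sumr_const; apply: eq_bigl => V.
by rewrite inE QW.
Qed.

Lemma sum_by_meet k f X (c : nat -> R) :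
  \sum_(W | \dim W == k) f W * c (\dim (W :&: X)) =
  \sum_(r < k.+1) meet_sum k f r X * c r.
Proof.
have lt_dim W : \dim W == k -> (\dim (W :&: X) < k.+1)%N.
  by move=> /eqP <-; rewrite ltnS dimvS ?capvSl.
rewrite (partition_big (fun W => inord (\dim (W :&: X)) : 'I_k.+1) xpredT) //=.
apply: eq_bigr => r _; rewrite /meet_sum mulr_suml.
have eqr W : \dim W == k ->
    (inord (\dim (W :&: X)) == r :> 'I_k.+1) = (\dim (W :&: X) == r :> nat).
  by move=> dW; rewrite -val_eqE /= inordK ?lt_dim.
apply: eq_big => W; first by apply: andb_id2l; apply: eqr.
by case/andP=> dW; rewrite eqr // => /eqP ->.
Qed.

(** Summing the harmonicity condition over the [Y] of dimension [s] inside [X]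
counts each [W] once for every such [Y] inside [W :&: X]. *)
Lemma meet_sum_moment k f s X : harmonic k f -> (s < k)%N ->
  \sum_(r < k.+1) meet_sum k f r X * (gauss F r s)%:R = 0.
Proof.
move=> hf lt_sk; rewrite -(sum_by_meet k f X (fun r => (gauss F r s)%:R)).
transitivity (\sum_(Y | (\dim Y == s) && (Y <= X)%VS)
   \sum_(W | (\dim W == k) && (Y <= W)%VS) f W); last first.
  by rewrite big1 // => Y /andP[/eqP dY _]; apply: hf; rewrite dY.
rewrite (double_count _ (fun W => \dim W == k) (fun W Y => (Y <= W)%VS)).
apply: eq_bigr => W _; congr (_ * _%:R).
transitivity (#|interval 0%VS (W :&: X)%VS s|).
  by rewrite card_interval_gauss ?sub0v ?dimv0 // !subn0.
by apply: eq_card => Y; rewrite !inE sub0v subv_cap /= andbC andbA andbAC.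
Qed.

Lemma meet_sum_top k f X : meet_sum k f k X = lift k f X.
Proof.
apply: eq_bigl => W; apply: andb_id2l => /eqP <-.
by rewrite (dimv_leqif_sup (capvSl W X)) subv_cap subvv /=.
Qed.

(** The moment equations for [s < k] form a triangular system that determines
the sums [meet_sum k f s X] from the top one, so it is enough that the claimed
values solve it. *)
Lemma meet_sum_harmonic k f r X : harmonic k f -> (r <= k)%N ->
  meet_sum k f r X = mobius (k - r) * (gauss F k r)%:R * lift k f X.
Proof.
move=> hf; have [m] := ubnP (k - r); elim: m r => // m IH s le_m.
rewrite leq_eqVlt => /predU1P[->|lt_sk].
  by rewrite meet_sum_top subnn gaussn /mobius bin0n !expr0 !mul1r.
pose b r := mobius (k - r) * (gauss F k r)%:R * lift k f X.
have : \sum_(r < k.+1) (meet_sum k f r X - b r) * (gauss F r s)%:R = 0.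
  under eq_bigr => r _ do rewrite mulrBl.
  rewrite sumrB meet_sum_moment // sub0r; apply/eqP; rewrite oppr_eq0; apply/eqP.
  have := alt_gauss_closed F R k 0 s; rewrite leqNgt lt_sk /= => e.
  transitivity (alt_gauss F R k 0 s * lift k f X); last by rewrite e mul0r.
  by rewrite mulr_suml; apply: eq_bigr => r _; rewrite /b add0n; ring.
have lt_s : (s < k.+1)%N by lia.
rewrite (bigD1 (Ordinal lt_s)) //= gaussn mulr1 big1 ?addr0 => [/eqP|r].
  by rewrite subr_eq0 => /eqP.
rewrite -val_eqE /= => ne_rs; case: (ltngtP r s) ne_rs => // [lt_rs|lt_sr] _.
  by rewrite gauss_small // mulr0.
by rewrite IH ?subrr ?mul0r //; have := ltn_ord r; lia.
Qed.

(** The number of [V] of dimension [j] between [W] and [U] depends on dimensions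
only. *)
Lemma lift_down k f j U : (k <= j)%N ->
  \sum_(V | (\dim V == j) && (V <= U)%VS) lift k f V =
    (gauss F (\dim U - k) (j - k))%:R * lift k f U.
Proof.
move=> le_kj; rewrite /lift.
rewrite (double_count _ (fun W => \dim W == k) (fun W V => (W <= V)%VS)).
rewrite mulr_sumr (bigID (fun W => (W <= U)%VS)) /= [X in _ + X]big1 ?addr0.
  apply: eq_bigr => W /andP[/eqP dW sWU]; rewrite mulrC; congr (_%:R * _).
  rewrite -dW -card_interval_gauss ?dW //; apply: eq_card => V.
  by rewrite !inE andbC [(_ == _) && _]andbC.
move=> W /andP[_ nsWU]; rewrite (_ : [set _ | _] = set0) ?cards0 ?mulr0 //.
apply/setP => V; rewrite !inE; apply: contraNF nsWU => /andP[/andP[_ sVU] sWV].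
exact: subv_trans sVU.
Qed.

Definition up_coef k s j : R :=
  \sum_(r < k.+1) mobius (k - r) * (gauss F k r)%:R *
     (gauss F (n - (k + s - r)) (n - j))%:R.

(** The number of [V] of dimension [j] above both [W] and [X] depends only on
[\dim (W :&: X)], so that the sum is a combination of the [meet_sum k f r X].
When [k + \dim X - r] exceeds [n] the subtraction in [up_coef] is truncated,
but then no [W] meets [X] in dimension [r] and both sides have a zero term. *)
Lemma lift_up k f j X : harmonic k f -> (j <= n)%N ->
  \sum_(V | (\dim V == j) && (X <= V)%VS) lift k f V =
    up_coef k (\dim X) j * lift k f X.
Proof.
move=> hf le_jn; rewrite /lift.
rewrite (double_count _ (fun W => \dim W == k) (fun W V => (W <= V)%VS)).
pose c r := (gauss F (n - (k + \dim X - r)) (n - j))%:R : R.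
transitivity (\sum_(W | \dim W == k) f W * c (\dim (W :&: X))).
  apply: eq_bigr => W /eqP dW; congr (_ * _%:R).
  transitivity (#|interval (W + X)%VS fullv j|).
    apply: eq_card => V; rewrite !inE subv_add subvf /=.
    by rewrite andbC [(_ == _) && _]andbC andbA.
  rewrite card_interval_gauss_sym ?subvf ?dim_fullv //.
  by rewrite -dW -(dimv_sum_cap W X) addnK.
rewrite sum_by_meet /up_coef mulr_suml; apply: eq_bigr => r _.
by rewrite (meet_sum_harmonic _ hf) -1?ltnS // /c mulrAC.
Qed.

Lemma lift_low k f U : (\dim U < k)%N -> lift k f U = 0.
Proof.
move=> lt_Uk; rewrite /lift big_pred0 // => W; apply/negbTE.
by rewrite negb_and orbC -implybE; apply/implyP => /dimvS; lia.
Qed.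

Lemma q_neq0 : q%:R != 0 :> R.
Proof. by rewrite pnatr_eq0 -lt0n (ltnW (q_gt1 F)). Qed.

Lemma gauss_neq0 a b : (b <= a)%N -> (gauss F a b)%:R != 0 :> R.
Proof. by move=> ?; rewrite pnatr_eq0 -lt0n gauss_gt0. Qed.

(** Here every [W] of dimension [k] meets [U] nontrivially, so that
[meet_sum k f 0 U] is an empty sum; but it is a nonzero multiple of
[lift k f U]. *)
Lemma lift_high k f U : harmonic k f -> (n < \dim U + k)%N -> lift k f U = 0.
Proof.
move=> hf lt_n; have := meet_sum_harmonic U hf (leq0n k).
rewrite {1}/meet_sum big_pred0 => [/esym/eqP|W].
  rewrite subn0 gauss0 mulr1 !mulf_eq0 signr_eq0 expf_eq0 (negbTE q_neq0) andbF.
  by move=> /eqP.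
apply/negbTE/negP => /andP[/eqP dW /eqP dWU].
have := dimv_sum_cap W U; rewrite dWU dW.
by have := dimvS (subvf (W + U)); rewrite dim_fullv; lia.
Qed.

Lemma up_coef_alt k s j : (k + s <= n)%N ->
  up_coef k s j = alt_gauss F R k (n - (k + s)) (n - j).
Proof.
move=> le_n; apply: eq_bigr => r _; congr (_ * (gauss F _ _)%:R).
by have := ltn_ord r; lia.
Qed.

Lemma up_coef_neq0 k j : (k <= j)%N -> (j + k <= n)%N -> up_coef k k j != 0.
Proof.
move=> le_kj le_n; rewrite up_coef_alt; last lia.
rewrite alt_gauss_closed ifT; last lia.
by rewrite mulf_neq0 ?expf_neq0 ?q_neq0 ?gauss_neq0 //; lia.
Qed.

End Harmonic.

(** * Existence of harmonic functions *)

Section Existence.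
Variables (F : finFieldType) (n : nat) (R : numFieldType).
Local Notation space := {vspace 'rV[F]_n}.

(** Adding up the sums over the [W] above each [Y] of dimension [k - 1] that
contains [X] gives a nonzero multiple of the sum over the [W] above [X]. *)
Lemma harmonic_pred k (f : space -> R) :
  (forall X, (\dim X).+1 = k ->
     \sum_(W | (\dim W == k) && (X <= W)%VS) f W = 0) -> harmonic k f.
Proof.
move=> hf X lt_Xk.
have k_gt0 : (0 < k)%N by lia.
have : \sum_(Y | (\dim Y == k.-1) && (X <= Y)%VS)
     \sum_(W | (\dim W == k) && (Y <= W)%VS) f W = 0.
  by apply: big1 => Y /andP[/eqP dY _]; apply: hf; rewrite dY prednK.
rewrite (double_count _ (fun W => \dim W == k) (fun W Y => (Y <= W)%VS)).
rewrite (bigID (fun W => (X <= W)%VS)) /= [X in _ + X]big1 ?addr0; last first.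
  move=> W /andP[_ nsXW]; rewrite (_ : [set _ | _] = set0) ?cards0 ?mulr0 //.
  apply/setP => Y; rewrite !inE; apply: contraNF nsXW => /andP[/andP[_]].
  exact: subv_trans.
set c : R := (gauss F (k - \dim X) (k.-1 - \dim X))%:R.
rewrite (eq_bigr (fun W => f W * c)) => [|W /andP[/eqP dW sXW]]; last first.
  congr (_ * _%:R); rewrite -dW -card_interval_gauss ?dW //; last lia.
  by apply: eq_card => Y; rewrite !inE -andbA andbC -andbA.
rewrite -mulr_suml => /eqP; rewrite mulf_eq0 (negbTE (gauss_neq0 _ _ _)) ?orbF.
  by move/eqP.
lia.
Qed.

Lemma harmonic_sum k m (c : 'I_m -> R) (h : 'I_m -> space -> R) :
  (forall a, harmonic k (h a)) -> harmonic k (fun W => \sum_a c a * h a W).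
Proof.
move=> hh X lt_X; rewrite exchange_big big1 //= => a _.
by rewrite -mulr_sumr hh ?mulr0.
Qed.

(** Harmonic functions form the kernel of the incidence matrix between
dimensions [k] and [k - 1]; its rank is at most the number of columns, which
leaves a kernel of dimension at least [multiplicity F n k]. *)
Lemma harmonic_family k :
  exists h : 'I_(multiplicity F n k) -> space -> R,
    (forall a, harmonic k (h a)) /\
    (forall c : 'I_(multiplicity F n k) -> R,
       (forall W, \dim W = k -> \sum_a c a * h a W = 0) -> forall a, c a = 0).
Proof.
pose S := [set U : space | \dim U == k].
pose T := [set X : space | (\dim X).+1 == k].
pose A : 'M[R]_(#|S|, #|T|) :=
  \matrix_(i, j) ((enum_val j : space) <= enum_val i)%VS%:R.
pose K := row_base (kermx A).
have le_mult : (multiplicity F n k <= \rank (kermx A))%N.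
  rewrite mxrank_ker /multiplicity.
  have -> : qbinom F n k = #|S| by [].
  have -> : qbinom F n (k%:Z - 1) = #|T|.
    case: k @S @T @A @K => [|k] S T A K.
      by apply/esym/eqP; rewrite cards_eq0; apply/eqP/setP => X; rewrite !inE.
    have -> : (k.+1%:Z - 1 = k%:Z)%R by lia.
    by apply: eq_card => X; rewrite !inE.
  by rewrite leq_sub2l // rank_leq_col.
pose h a W := \sum_i K (widen_ord le_mult a) i * (enum_val i == W)%:R.
have hE a i : h a (enum_val i) = K (widen_ord le_mult a) i.
  rewrite /h (bigD1 i) //= eqxx mulr1 big1 ?addr0 // => j ne_ji.
  by rewrite (inj_eq enum_val_inj) (negbTE ne_ji) mulr0.
exists h; split=> [a|c hc a].
  apply: harmonic_pred => X dX.
  have TX : X \in T by rewrite inE dX.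
  have KA : K *m A = 0 by apply/sub_kermxP; rewrite eq_row_base.
  transitivity ((K *m A) (widen_ord le_mult a) (enum_rank_in TX X)); last first.
    by rewrite KA mxE.
  rewrite mxE.
  rewrite (eq_bigl (fun W => (W \in S) && (X <= W)%VS)); last by move=> W; rewrite inE.
  rewrite big_mkcondr big_enum_val; apply: eq_bigr => i _.
  rewrite hE [A _ _]mxE enum_rankK_in //.
  by case: ifP => _; rewrite ?mulr1 ?mulr0.
(* The coefficients [c], padded with zeros to the full height of [K]. *)
pose c' : 'rV[R]_(\rank (kermx A)) :=
  \sum_b c b *: delta_mx 0 (widen_ord le_mult b).
have c'K : c' *m K = 0.
  apply/rowP => i; rewrite [RHS]mxE mulmx_suml summxE.
  rewrite -[RHS](hc (enum_val i)); last by have := enum_valP i; rewrite inE => /eqP.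
  apply: eq_bigr => b _.
  by rewrite hE -scalemxAl -rowE [LHS]mxE [X in _ * X]mxE.
have : c' = 0.
  by apply/eqP; rewrite -(mulmx_free_eq0 _ (row_base_free (kermx A))); apply/eqP.
move=> /(congr1 (fun M : 'rV_ _ => M 0 (widen_ord le_mult a))).
rewrite [RHS]mxE summxE (bigD1 a) //= big1 ?addr0 => [|b ne_ba].
  by rewrite !mxE !eqxx mulr1.
rewrite !mxE eqxx /= (_ : (_ == _) = false) ?mulr0 //.
by apply: contraNF ne_ba => /eqP [] /val_inj ->.
Qed.

End Existence.

(** * Counting the lifts *)

Section Dimensions.
Variables (F : finFieldType) (n : nat).

(** The lowest level of the block [k].  It is [k], except that the zero subspace
is not a vertex. *)
Definition base_level (k : nat) : nat := if k is 0 then 1 else k.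

(** The sum telescopes; with truncated differences it can only be larger. *)
Lemma gauss_le_sum_multiplicity m :
  (gauss F n m <= \sum_(k < m.+1) multiplicity F n k)%N.
Proof.
elim: m => [|m IH]; first by rewrite big_ord1 /multiplicity subn0.
rewrite big_ord_recr /= [X in (_ + X)%N]/multiplicity.
have -> : (m.+1%:Z - 1 = m%:Z)%R by lia.
apply: leq_trans (leq_add IH (leqnn _)).
by rewrite -leq_subLR.
Qed.

(** The condition on [k] says that [k] is at most [minn i (n - i)], and [gauss n]
takes the same value at [i] and at that minimum. *)
Lemma gauss_le_level i : (i <= n)%N ->
  (gauss F n i <=
    \sum_(k < n./2.+1 | (k <= i <= n - k)%N) multiplicity F n k)%N.
Proof.
move=> le_in; set m := minn i (n - i).
have -> : gauss F n i = gauss F n m.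
  by rewrite /m; case: (leqP i (n - i)) => // _; rewrite gauss_sym.
apply: leq_trans (gauss_le_sum_multiplicity m) _.
have le_m : (m.+1 <= n./2.+1)%N by rewrite /m; lia.
rewrite (big_ord_widen _ (multiplicity F n) le_m) big_mkcond [leqRHS]big_mkcond.
by apply: leq_sum => k _; rewrite /m; case: ifP => // h; rewrite ifT //; lia.
Qed.

(** The size of the block [k] is the number of levels on which the lifts of a
harmonic function of dimension [k] live. *)
Lemma Ltilde_size_level k : (0 < n)%N -> (k <= n./2)%N ->
  Ltilde_size n k = (\sum_(i < n.-1) (k <= i.+1 <= n - k))%N.
Proof.
move=> n_gt0 le_k.
have count N a b : (\sum_(i < N) (a <= i.+1 <= b) = minn N b - a.-1)%N.
  by elim: N => [|N IH]; rewrite ?big_ord0 ?big_ord_recr /= ?IH; lia.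
by rewrite count; case: k le_k => [|k] /= le_k; lia.
Qed.

Lemma sum_gauss_le : (0 < n)%N ->
  (\sum_(i < n.-1) gauss F n i.+1 <=
     \sum_(k < n./2.+1) multiplicity F n k * Ltilde_size n k)%N.
Proof.
move=> n_gt0.
rewrite (eq_bigr (fun k : 'I_n./2.+1 =>
   \sum_(i < n.-1 | (k <= i.+1 <= n - k)%N) multiplicity F n k)%N); last first.
  move=> k _; have le_k : (k <= n./2)%N by rewrite -ltnS.
  rewrite (Ltilde_size_level n_gt0 le_k) big_distrr [RHS]big_mkcond /=.
  by apply: eq_bigr => i _; case: ifP; rewrite ?muln1 ?muln0.
rewrite (exchange_big_dep xpredT) //=; apply: leq_sum => i _; apply: gauss_le_level.
by have := ltn_ord i; lia.
Qed.

End Dimensions.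

(** * Weights of flags *)

Section Transport.
Variables (K : fieldType) (vT : vectType K).
Implicit Types A B : {vspace vT}.

Lemma adapted_basis A B : (A <= B)%VS ->
  exists X Y Z, [/\ basis_of A X, basis_of B (X ++ Y) & basis_of fullv (X ++ Y ++ Z)].
Proof.
move=> sAB; exists (vbasis A), (vbasis (B :\: A)), (vbasis (B^C)).
have bB : basis_of B (vbasis A ++ vbasis (B :\: A)).
  have {1}-> : B = (A + (B :\: A))%VS by rewrite addvC addv_diff; apply/esym/addv_idPl.
  by apply: cat_basis; rewrite ?vbasisP//; apply/directv_addP; rewrite capvC capv_diff.
split=> //; first exact: vbasisP.
rewrite catA -(addv_complf B); apply: cat_basis; rewrite ?vbasisP//.
by apply/directv_addP; exact: capv_compl.
Qed.

Lemma basis_size (X : seq vT) A : basis_of A X -> size X = \dim A.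
Proof. by move=> bX; rewrite -(size_basis (X := in_tuple X) bX). Qed.

Lemma transport_chain A B A' B' :
  (A <= B)%VS -> (A' <= B')%VS -> \dim A = \dim A' -> \dim B = \dim B' ->
  exists g : 'End(vT), [/\ lker g == 0%VS, (g @: A = A')%VS & (g @: B = B')%VS].
Proof.
move=> /adapted_basis[X [Y [Z [bA bB bT]]]] /adapted_basis[X' [Y' [Z' [bA' bB' bT']]]].
move=> eA eB.
have sX : size X = size X' by rewrite (basis_size bA) eA (basis_size bA').
have sXY : size (X ++ Y) = size (X' ++ Y').
  by rewrite (basis_size bB) eB (basis_size bB').
have [f fE] := linear_of_free (X ++ Y ++ Z) (X' ++ Y' ++ Z').
have {}fE : map (linfun f) (X ++ Y ++ Z) = X' ++ Y' ++ Z'.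
  rewrite -fE ?(basis_free bT) // ?(basis_size bT) ?(basis_size bT') //.
  by apply: eq_map => v; rewrite lfunE.
have fX : map (linfun f) X = X'.
  have := congr1 (take (size X)) fE.
  by rewrite map_cat take_size_cat ?size_map // sX take_size_cat.
have fXY : map (linfun f) (X ++ Y) = X' ++ Y'.
  have := congr1 (take (size (X ++ Y))) fE.
  by rewrite !catA map_cat take_size_cat ?size_map // sXY take_size_cat.
exists (linfun f); split.
- rewrite -dimv_eq0 -(eqn_add2r (\dim (limg (linfun f)))) add0n.
  rewrite -[in X in X == _](capfv (lker _)) limg_ker_dim.
  by rewrite -{2}(span_basis bT) limg_span fE (span_basis bT').
- by rewrite -(span_basis bA) limg_span fX (span_basis bA').
- by rewrite -(span_basis bB) limg_span fXY (span_basis bB').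
Qed.

End Transport.

Section Weights.
Variables (F : finFieldType) (n : nat).
Local Notation vertex := (vertex F n).
Implicit Types (U V W : vertex) (f : {set vertex}).

Definition vdim U : nat := \dim (val U).

Definition comparable U V : bool := vsub U V || vsub V U.

Lemma vdim_bounds U : (0 < vdim U < n)%N.
Proof.
have /andP[U0 UT] := valP U; rewrite /vdim lt0n dimv_eq0 U0 /=.
rewrite -[ltnRHS](dim_fullv F n) ltn_neqAle dimvS ?subvf // andbT.
by rewrite (dimv_leqif_eq (subvf _)).
Qed.

Lemma comparable_dim_inj U V : comparable U V -> vdim U = vdim V -> U = V.
Proof.
move=> cUV eUV; apply/val_inj/eqP; case/orP: cUV => s.
  by rewrite eqEdim -/(vsub U V) s -/(vdim V) -eUV leqnn.
by rewrite eq_sym eqEdim -/(vsub V U) s -/(vdim U) eUV leqnn.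
Qed.

Lemma flag_comparable f U V : is_flag f -> U \in f -> V \in f -> comparable U V.
Proof. by move=> /forall_inP h /h/forall_inP h' /h'. Qed.

(** The dimension is injective on a flag, and a complete flag has as many members
as there are possible dimensions. *)
Lemma complete_flag_level f j : complete_flag f -> (0 < j < n)%N ->
  exists2 V, V \in f & vdim V = j.
Proof.
move=> /andP[ff /eqP cf] /andP[j_gt0 lt_jn].
have lt_d V : ((vdim V).-1 < n.-1)%N by have := vdim_bounds V; lia.
pose lev V : 'I_n.-1 := Ordinal (lt_d V).
have lev_inj : {in f &, injective lev}.
  move=> U V Uf Vf [eUV]; apply: comparable_dim_inj.
    exact: flag_comparable Uf Vf.
  by have := vdim_bounds U; have := vdim_bounds V; lia.
have /setP full : lev @: f = setT.
  apply/eqP; rewrite eqEcard subsetT cardsT card_ord (card_in_imset lev_inj).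
  by rewrite cf leqnn.
have lt_j : (j.-1 < n.-1)%N by lia.
have /imsetP[V Vf [eV]] : Ordinal lt_j \in lev @: f by rewrite full inE.
by exists V => //; have := vdim_bounds V; lia.
Qed.

(** Double counting of the pairs of a complete flag through [U] and its member of
dimension [j]. *)
Lemma sum_weight_level U j : (0 < j < n)%N ->
  (\sum_(V | (vdim V == j) && comparable U V) weight [set U; V] = weight [set U])%N.
Proof.
move=> j_bounds; rewrite /weight -[RHS]sum1_card.
under eq_bigr => V _ do rewrite -sum1_card.
rewrite (exchange_big_dep
  (fun f => f \in [set f : {set vertex} | complete_flag f & [set U] \subset f])) /=.
  apply: eq_bigr => f; rewrite inE sub1set => /andP[cf Uf].
  have [V Vf dV] := complete_flag_level cf j_bounds.
  have ff : is_flag f by case/andP: cf.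
  rewrite (eq_bigl (pred1 V)) ?big_pred1_eq // => W /=.
  rewrite inE cf subUset !sub1set Uf /=; apply/idP/eqP => [|->].
    case/andP=> /andP[/eqP dW _] Wf; apply: comparable_dim_inj; last by rewrite dV.
    exact: flag_comparable Wf Vf.
  by rewrite dV eqxx Vf andbT (flag_comparable ff).
by move=> V f _; rewrite !inE subUset => /and3P[-> -> _].
Qed.

Lemma sum_weight_neighbours U :
  (\sum_(V | (V != U) && comparable U V) weight [set U; V]
    = (n - 2) * weight [set U])%N.
Proof.
rewrite /weight mulnC -sum_nat_const.
under eq_bigr => V _ do rewrite -sum1_card.
rewrite (exchange_big_dep
  (fun f => f \in [set f : {set vertex} | complete_flag f & [set U] \subset f])) /=.
  apply: eq_bigr => f; rewrite inE sub1set => /andP[cf Uf].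
  have [ff /eqP fn] := andP cf.
  have -> : (n - 2 = #|f :\ U|)%N.
    by have := cardsD1 U f; rewrite Uf fn; set c := #|_|; lia.
  rewrite -sum1_card; apply: eq_bigl => V; rewrite !inE cf subUset !sub1set Uf /=.
  case: (boolP (V \in f)) => Vf; rewrite ?andbF // !andbT.
  by rewrite (flag_comparable ff Uf Vf) andbT.
by move=> V f _; rewrite !inE subUset => /and3P[-> -> _].
Qed.

(** A linear automorphism carrying the chain [(U, V)] to [(U', V')] injects the
complete flags through the former into those through the latter. *)
Lemma weight_pair_le U V U' V' : vsub U V -> vsub U' V' ->
  vdim U = vdim U' -> vdim V = vdim V' ->
  (weight [set U; V] <= weight [set U'; V'])%N.
Proof.
move=> sUV sUV' eU eV.
have [g [kg gU gV]] := transport_chain sUV sUV' eU eV.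
have g_inj : injective (fun X : {vspace 'rV[F]_n} => g @: X)%VS.
  by move=> X Y /eqP; rewrite eq_limg_ker0 // => /eqP.
have gP W : nontrivial_subspace (g @: val W)%VS.
  have /andP[W0 WT] := valP W; apply/andP; split.
    by apply: contraNneq W0 => e; apply/eqP/g_inj; rewrite e limg0.
  by apply: contraNneq WT => e; apply/eqP/g_inj; rewrite e lker0_limgf.
pose G W : vertex := exist _ (g @: val W)%VS (gP W).
have G_inj : injective G.
  by move=> X Y /(congr1 val)/g_inj/val_inj.
rewrite /weight -(card_imset _ (imset_inj G_inj)); apply/subset_leq_card/subsetP.
move=> _ /imsetP[f + ->]; rewrite !inE => /andP[/andP[/forall_inP ff cf]].
rewrite !subUset !sub1set => /andP[Uf Vf].
have -> : U' = G U by apply/val_inj; rewrite /= gU.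
have -> : V' = G V by apply/val_inj; rewrite /= gV.
rewrite /complete_flag card_imset // cf !imset_f // !andbT.
apply/forall_inP => _ /imsetP[X Xf ->]; apply/forall_inP => _ /imsetP[Y Yf ->].
by rewrite /vsub /= !limg_ker0 //; have /forall_inP/(_ Y Yf) := ff X Xf.
Qed.

Lemma weight_pair_eq U V U' V' : vsub U V -> vsub U' V' ->
  vdim U = vdim U' -> vdim V = vdim V' ->
  weight [set U; V] = weight [set U'; V'].
Proof. by move=> *; apply/eqP; rewrite eqn_leq !weight_pair_le. Qed.

(** All terms of [sum_weight_level] are equal. *)
Lemma weight_pair_level U V : comparable U V ->
  (weight [set U; V] * #|[set W | (vdim W == vdim V) && comparable U W]|
     = weight [set U])%N.
Proof.
move=> cUV; rewrite -(sum_weight_level U (vdim_bounds V)) mulnC -sum_nat_const.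
apply: eq_big => W; rewrite inE // => /andP[/eqP dW cUW].
have sub X Y : comparable X Y -> (vdim X <= vdim Y)%N -> vsub X Y.
  case/orP=> // s le_d; suff -> : X = Y by exact: subvv.
  apply: comparable_dim_inj; first by rewrite /comparable s orbT.
  by apply/eqP; rewrite eqn_leq le_d dimvS.
have symc X Y : comparable X Y = comparable Y X by rewrite /comparable orbC.
case: (leqP (vdim U) (vdim V)) => [le|/ltnW le].
  by apply: weight_pair_eq; rewrite ?sub ?dW.
by rewrite setUC [in RHS]setUC; apply: weight_pair_eq; rewrite ?sub ?dW // symc.
Qed.

Lemma vertex_level_image (P : pred {vspace 'rV[F]_n}) j : (0 < j < n)%N ->
  val @: [set V : vertex | (vdim V == j) && P (val V)]
    = [set V | (\dim V == j) && P V].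
Proof.
move=> j_bounds; apply/setP => V.
apply/imsetP/idP => [[W + ->]|]; first by rewrite !inE.
rewrite inE => /andP[/eqP dV PV].
have ntV : nontrivial_subspace V.
  rewrite /nontrivial_subspace -dimv_eq0 dV; apply/andP; split; first lia.
  by apply: contraTneq j_bounds => eV; rewrite -dV eV dim_fullv; lia.
by exists (exist _ V ntV); rewrite ?inE //= /vdim /= dV eqxx.
Qed.

Lemma card_vertex_level (P : pred {vspace 'rV[F]_n}) j : (0 < j < n)%N ->
  #|[set V : vertex | (vdim V == j) && P (val V)]|
    = #|[set V | (\dim V == j) && P V]|.
Proof.
by move=> j_bounds; rewrite -vertex_level_image // card_imset //; apply: val_inj.
Qed.

Lemma sum_vertex_level (R : nmodType) (P : pred {vspace 'rV[F]_n})
    (G : {vspace 'rV[F]_n} -> R) j : (0 < j < n)%N ->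
  \sum_(V : vertex | (vdim V == j) && P (val V)) G (val V)
    = \sum_(V | (\dim V == j) && P V) G V.
Proof.
move=> j_bounds.
transitivity (\sum_(V in val @: [set V : vertex | (vdim V == j) && P (val V)]) G V).
  rewrite big_imset /=; last by move=> U V _ _; apply: val_inj.
  by apply: eq_bigl => V; rewrite inE.
by rewrite vertex_level_image //; apply: eq_bigl => V; rewrite inE.
Qed.

End Weights.

(** * The Laplacian on one level *)

Section Laplacian.
Variables (F : finFieldType) (n : nat) (R : realType).
Local Notation vertex := (vertex F n).
Local Notation space := {vspace 'rV[F]_n}.
Local Notation cochain0 := (cochain0 F n R).
Local Notation Delta := (@upper_laplacian0 F n R).
Implicit Types (U V W : vertex) (phi : cochain0).

Lemma sum_edges (H : vertex * vertex -> R) :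
  \sum_(e : edge F n | vproper (src e) (tgt e)) H (val e)
    = \sum_V \sum_(W | vproper V W) H (V, W).
Proof.
rewrite (pair_big_dep xpredT (fun V W => vproper V W) (fun V W => H (V, W))) /=.
rewrite (eq_bigl (fun p => p \in val @: [set e : edge F n | vproper (src e) (tgt e)])).
  rewrite big_imset /=; last by move=> d e _ _; apply: val_inj.
  by apply: eq_big => e; rewrite ?inE //; case: (val e).
case=> V W /=; apply/idP/imsetP => [pVW|[e + eVW]]; last first.
  by rewrite inE /src /tgt -[val e]eVW.
have eP : is_edge (V, W).
  have /andP[ne sVW] := pVW; rewrite /is_edge /= ne /=.
  apply/forall_inP => X /set2P[] ->; apply/forall_inP => Y /set2P[] ->;
  by rewrite ?sVW ?orbT // orbb /vsub subvv.
by exists (exist _ (V, W) eP); rewrite ?inE.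
Qed.

(** The adjunction is tested against the indicator function of [U]. *)
Lemma upper_laplacian0E phi U :
  (weight [set U])%:R * Delta phi U =
    \sum_(V | (V != U) && comparable U V)
      (weight [set U; V])%:R * (phi U - phi V).
Proof.
pose delta : cochain0 := [ffun V => (V == U)%:R : R^o].
have := d0_adjP delta (d0 phi).
have -> : inner0 delta (d0_adj F n R (d0 phi)) = (weight [set U])%:R * Delta phi U.
  rewrite /inner0 (bigD1 U) //= ffunE eqxx mulr1 big1 ?addr0 // => V /negbTE VU.
  by rewrite ffunE VU mulr0 mul0r.
move=> <-.
pose H (p : vertex * vertex) : R := (weight [set p.1; p.2])%:R *
  ((p.2 == U)%:R - (p.1 == U)%:R) * (phi p.2 - phi p.1).
transitivity (\sum_(e : edge F n | vproper (src e) (tgt e)) H (val e)).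
  by apply: eq_bigr => e _; rewrite /= !ffunE.
pose G V W : R := (weight [set V; W])%:R * (phi W - phi V).
transitivity (\sum_V \sum_(W | vproper V W) (W == U)%:R * G V W
            - \sum_V \sum_(W | vproper V W) (V == U)%:R * G V W).
  rewrite sum_edges -sumrB; apply: eq_bigr => V _; rewrite -sumrB.
  by apply: eq_bigr => W _; rewrite /H /G /=; ring.
have -> : \sum_V \sum_(W | vproper V W) (V == U)%:R * G V W
          = \sum_(V | vproper U V) G U V.
  rewrite (bigD1 U) //= [X in _ + X]big1 ?addr0 => [|V /negbTE VU].
    by apply: eq_bigr => V _; rewrite eqxx mul1r.
  by apply: big1 => W _; rewrite VU mul0r.
have -> : \sum_V \sum_(W | vproper V W) (W == U)%:R * G V W
          = \sum_(V | vproper V U) G V U.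
  rewrite (exchange_big_dep xpredT) //= (bigD1 U) //= [X in _ + X]big1 ?addr0.
    by apply: eq_bigr => V _; rewrite eqxx mul1r.
  by move=> W /negbTE WU; apply: big1 => V _; rewrite WU mul0r.
rewrite [RHS](bigID (fun V => vsub U V)) /= [RHS]addrC -sumrN.
congr (_ + _); last first.
  apply: eq_big => V; last by rewrite /G => _; ring.
  by rewrite /vproper /comparable eq_sym; case: (vsub U V); rewrite ?andbT ?andbF.
apply: eq_big => V; last by rewrite /G setUC.
rewrite /vproper /comparable; case: (boolP (V == U)) => //= ne.
case: (boolP (vsub U V)) => sUV; rewrite ?andbT ?andbF //=.
apply/negbTE; apply: contra ne => sVU; apply/eqP/val_inj/eqP.
by rewrite eqEsubv; apply/andP.
Qed.

Lemma weight_ratio U V : comparable U V ->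
  (weight [set U; V])%:R / (weight [set U])%:R =
    #|[set W | (vdim W == vdim V) && comparable U W]|%:R^-1 :> R.
Proof.
move=> cUV; rewrite -(weight_pair_level cUV) natrM invfM mulrA.
rewrite divff ?mul1r // pnatr_eq0 -lt0n.
by have := weight1_gt0 U; rewrite -(weight_pair_level cUV) muln_gt0 => /andP[].
Qed.

Definition level_cochain j (g : space -> R) : cochain0 :=
  [ffun V => (if vdim V == j then g (val V) else 0) : R^o].

Lemma comparable_above U V : (vdim U < vdim V)%N -> comparable U V = vsub U V.
Proof.
rewrite /comparable; case: (boolP (vsub V U)) => [/dimvS le_VU|_ _].
  by rewrite ltnNge le_VU.
by rewrite orbF.
Qed.

Lemma comparable_below U V : (vdim V < vdim U)%N -> comparable U V = vsub V U.
Proof. by move=> /comparable_above <-; rewrite /comparable orbC. Qed.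

(** Only the subspaces of dimension [j] contribute to the average over the
neighbours of [U], and the three cases are those of [Ltilde_entry]. *)
Lemma laplacian_level j g U : (0 < j < n)%N ->
  Delta (level_cochain j g) U =
    if vdim U == j then (n%:R - 2) * g (val U)
    else if (vdim U < j)%N then
      - (\sum_(V | (\dim V == j) && (val U <= V)%VS) g V)
        / (gauss F (n - vdim U) (j - vdim U))%:R
    else
      - (\sum_(V | (\dim V == j) && (V <= val U)%VS) g V)
        / (gauss F (vdim U) j)%:R.
Proof.
move=> j_bounds.
have w0 : (weight [set U])%:R != 0 :> R by rewrite pnatr_eq0 -lt0n weight1_gt0.
apply: (mulfI w0); rewrite upper_laplacian0E.
under eq_bigr => V _ do rewrite mulrBr.
rewrite sumrB -mulr_suml -natr_sum sum_weight_neighbours ffunE.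
case: (eqVneq (vdim U) j) => [eU|neU].
  rewrite big1 ?subr0 => [|V /andP[VU cUV]].
    by rewrite natrM natrB //; [ring | lia].
  rewrite ffunE; case: (eqVneq (vdim V) j) => [eV|_]; rewrite ?mulr0 //.
  by case/eqP: VU; apply/esym/comparable_dim_inj; rewrite // eU.
rewrite mulr0 sub0r.
have -> : \sum_(V | (V != U) && comparable U V)
    (weight [set U; V])%:R * level_cochain j g V
  = (weight [set U])%:R / #|[set W | (vdim W == j) && comparable U W]|%:R *
     \sum_(V | (vdim V == j) && comparable U V) g (val V).
  rewrite mulr_sumr big_mkcond [RHS]big_mkcond; apply: eq_bigr => V _.
  rewrite ffunE; case: (eqVneq (vdim V) j) => [eV|_]; last by rewrite mulr0 if_same.
  have -> : V != U by apply: contraNneq neU => <-; rewrite eV.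
  case: ifP => //= cUV; congr (_ * _).
  have := weight_ratio cUV; rewrite eV => <-.
  by rewrite mulrCA divff ?mulr1.
rewrite -[in LHS]mulrA -mulrN [X in - X]mulrC; congr (_ * _).
move: neU; case: ltngtP => // lt_Uj _; rewrite mulNr; congr (- _).
  pose P := fun V : space => (val U <= V)%VS.
  have cP (V : vertex) : (vdim V == j) && comparable U V = (vdim V == j) && P (val V).
    by apply: andb_id2l => /eqP dV; rewrite comparable_above ?dV.
  rewrite (eq_bigl _ _ cP) (sum_vertex_level P g j_bounds); congr (_ / _%:R).
  transitivity #|interval (val U) fullv j|.
    rewrite (_ : [set _ | _] = [set V : vertex | (vdim V == j) && P (val V)]).
      rewrite (card_vertex_level P j_bounds); apply: eq_card => V.
      by rewrite !inE subvf andbC.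
    by apply/setP => V; rewrite !inE.
  by rewrite card_interval_gauss ?subvf ?dim_fullv // ltnW.
pose P := fun V : space => (V <= val U)%VS.
have cP (V : vertex) : (vdim V == j) && comparable U V = (vdim V == j) && P (val V).
  by apply: andb_id2l => /eqP dV; rewrite comparable_below ?dV.
rewrite (eq_bigl _ _ cP) (sum_vertex_level P g j_bounds); congr (_ / _%:R).
transitivity #|interval 0%VS (val U) j|.
  rewrite (_ : [set _ | _] = [set V : vertex | (vdim V == j) && P (val V)]).
    rewrite (card_vertex_level P j_bounds); apply: eq_card => V.
    by rewrite !inE sub0v andbC.
  by apply/setP => V; rewrite !inE.
by rewrite card_interval_gauss ?sub0v ?dimv0 // !subn0.
Qed.

End Laplacian.

(** * Entries of the blocks *)

Section Entries.
Variables (F : finFieldType) (n : nat) (R : realType).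
Local Notation space := {vspace 'rV[F]_n}.

(** The exponent of [q] is that of the Moebius function, as
['C(r.+1, 2) + 'C(k, 2) - r * k = 'C(k - r, 2)], and the last factor is
[gauss] with its lower argument complemented, so that it stays natural. *)
Lemma cijk_up_coef i j k : (i + k <= n)%N -> (i < j <= n)%N ->
  cijk R F n i j k = up_coef F n R k i j.
Proof.
move=> le_n /andP[lt_ij le_jn]; apply: eq_bigr => r _; rewrite /mobius.
have lt_r := ltn_ord r.
have -> : ('C(r.+1, 2)%:Z + 'C(k, 2)%:Z - (r * k)%:Z = 'C(k - r, 2)%:Z)%R.
  have e m : ('C(m, 2) * 2 = m * m.-1)%N.
    by elim: m => // m IH; rewrite binS bin1; nia.
  by have := e r.+1; have := e k; have := e (k - r)%N; nia.
congr (_ * _%:R).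
have -> : (n%:Z - i%:Z - k%:Z + r%:Z = (n - (k + i - r))%N%:Z)%R by lia.
case: (leqP (k + i - r) j) => le_j.
  have -> : (j%:Z - i%:Z - k%:Z + r%:Z = (j - (k + i - r))%N%:Z)%R by lia.
  rewrite -/(gauss F _ _) -gauss_sym; last lia.
  by congr gauss; lia.
rewrite gauss_small; last lia.
case e : (_ + r%:Z)%R => [b|b] //; lia.
Qed.

Lemma laplacian_lift k f j (U : vertex F n) : harmonic k f ->
  (0 < j < n)%N -> (k <= j <= n - k)%N ->
  upper_laplacian0 F n R (level_cochain j (lift k f)) U =
    Ltilde_entry R F n k (vdim U) j * lift k f (val U).
Proof.
move=> hf j_bounds /andP[le_kj le_jn].
have qE a b : (b <= a)%N -> (a%:Z - b%:Z = (a - b)%N%:Z)%R by lia.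
have U_bounds := vdim_bounds U.
rewrite laplacian_level // /Ltilde_entry; case: ltngtP => // lt_Uj.
- rewrite lift_up //; last lia.
  by rewrite cijk_up_coef ?qE ?mulNr 1?mulrAC //; lia.
- by rewrite lift_down // !qE ?mulNr 1?mulrAC //; lia.
Qed.

(** For [k = 0] the general formula for the entries gives back [-1]: both
quotients of Gaussian binomials are trivial. *)
Lemma Ltilde_entry0 i j : (i <= n)%N -> (j <= n)%N ->
  Ltilde_entry R F n 0 i j = if i == j then n%:R - 2 else - 1.
Proof.
move=> le_in le_jn; rewrite /Ltilde_entry; case: ltngtP => // lt.
- rewrite cijk_up_coef ?addn0 ?lt // /up_coef big_ord1 /mobius gauss0 bin0n !expr0.
  have -> : (n%:Z - i%:Z = (n - i)%N%:Z)%R by lia.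
  have -> : (j%:Z - i%:Z = (j - i)%N%:Z)%R by lia.
  rewrite -/(gauss F _ _) add0n subn0 !mul1r mulNr -(@gauss_sym F _ (j - i)); last lia.
  have -> : (n - i - (j - i) = n - j)%N by lia.
  by rewrite divff ?gauss_neq0 //; lia.
- by rewrite !subr0 -/(gauss F _ _) mulNr divff ?gauss_neq0 // ltnW.
Qed.

Lemma LtildeE k (l l' : 'I_(Ltilde_size n k)) :
  Ltilde R F n k l l' = Ltilde_entry R F n k (base_level k + l)%N (base_level k + l')%N.
Proof.
case: k l l' => [|k] l l'; rewrite mxE //.
rewrite Ltilde_entry0 /base_level ?eqn_add2l //.
- by have := ltn_ord l; rewrite /=; lia.
- by have := ltn_ord l'; rewrite /=; lia.
Qed.

Lemma level_bounds k (l : 'I_(Ltilde_size n k)) : (1 < n)%N -> (k <= n./2)%N ->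
  (0 < base_level k + l < n)%N /\ (k <= base_level k + l <= n - k)%N.
Proof.
move=> n_gt1 le_k; have := ltn_ord l; rewrite /base_level.
by case: k le_k l => [|k] le_k l /= lt_l; split; lia.
Qed.

Lemma level_ord k i : (0 < i < n)%N -> (k <= i <= n - k)%N ->
  exists l : 'I_(Ltilde_size n k), (base_level k + l)%N = i.
Proof.
move=> i_bounds i_range.
have lt_l : (i - base_level k < Ltilde_size n k)%N.
  by rewrite /base_level; case: k i_range => [|k] /=; lia.
exists (Ordinal lt_l) => /=; rewrite /base_level.
by case: k i_range {lt_l} => [|k]; lia.
Qed.

(** At a vertex whose dimension is a level of the block this is [laplacian_lift];
at the other vertices both sides vanish, as the lift does. *)
Lemma laplacian_level_lift k f (l : 'I_(Ltilde_size n k)) :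
  (1 < n)%N -> (k <= n./2)%N -> harmonic k f ->
  upper_laplacian0 F n R (level_cochain (base_level k + l)%N (lift k f)) =
    \sum_(l' < Ltilde_size n k)
      Ltilde R F n k l' l *: level_cochain (base_level k + l')%N (lift k f).
Proof.
move=> n_gt1 le_k hf; have [j_bounds j_range] := level_bounds l n_gt1 le_k.
apply/ffunP => U; rewrite (laplacian_lift _ hf) // sum_ffunE.
case: (boolP (k <= vdim U <= n - k)%N) => [U_range|].
  have [l' eU] := level_ord (vdim_bounds U) U_range.
  rewrite (bigD1 l') //= big1 ?addr0 => [|m ne_m].
    by rewrite !ffunE LtildeE eU eqxx.
  rewrite !ffunE -eU eqn_add2l eq_sym.
  by rewrite (_ : (m == l' :> nat) = false) ?scaler0 //; apply/negbTE.
have U_bounds := vdim_bounds U.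
move=> out; have U0 : lift k f (val U) = 0.
  move: out; rewrite negb_and -!ltnNge => /orP[lt|lt]; first exact: lift_low.
  by apply: (lift_high hf); rewrite -/(vdim U); lia.
rewrite U0 mulr0 big1 // => m _; rewrite !ffunE U0.
by rewrite if_same scaler0.
Qed.

Lemma lift_sum k m (c : 'I_m -> R) (h : 'I_m -> space -> R) U :
  lift k (fun W => \sum_a c a * h a W) U = \sum_a c a * lift k (h a) U.
Proof. by rewrite /lift exchange_big; apply: eq_bigr => a _; rewrite mulr_sumr. Qed.

Lemma lift_self k (f : space -> R) U : \dim U = k -> lift k f U = f U.
Proof.
move=> dU; rewrite /lift (eq_bigl (pred1 U)) ?big_pred1_eq // => W /=.
apply/andP/eqP => [[/eqP dW sWU]|->]; last by rewrite dU eqxx subvv.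
by apply/eqP; rewrite eqEdim sWU dU dW leqnn.
Qed.

Lemma dim_cochain0 : (0 < n)%N ->
  \dim (fullv : {vspace cochain0 F n R}) = (\sum_(i < n.-1) gauss F n i.+1)%N.
Proof.
move=> n_gt0; rewrite dimvf /dim /= muln1.
rewrite -sum1_card.
have lt_d V : ((@vdim F n V).-1 < n.-1)%N by have := vdim_bounds V; lia.
rewrite (partition_big (fun V => Ordinal (lt_d V)) xpredT) //=.
apply: eq_bigr => i _; rewrite sum1_card.
have i_bounds : (0 < i.+1 < n)%N by have := ltn_ord i; lia.
transitivity #|[set V : vertex F n | (vdim V == i.+1) && predT (val V)]|.
  apply: eq_card => V; rewrite [RHS]inE andbT.
  transitivity ((vdim V).-1 == i :> nat); first by [].
  by have := vdim_bounds V; lia.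
rewrite (card_vertex_level predT i_bounds); apply: eq_card => V.
by rewrite !inE andbT.
Qed.

End Entries.

(** * Independence of the lifts and the block diagonal form *)

Section Blocks.

(** Summation over the rows of a block diagonal matrix whose [k]-th block is a
Kronecker product of an identity matrix of size [r k] with one of size [s k]. *)
Lemma sum_block_index (V : nmodType) m (r s : nat -> nat)
    (H : forall k : 'I_m, 'I_(r k) -> 'I_(s k) -> V) :
  \sum_(t < \sum_(k < m) r k * s k)
     H (tagnat.sig1 t) (mxtens_unindex (tagnat.sig2 t)).1
       (mxtens_unindex (tagnat.sig2 t)).2
  = \sum_k \sum_a \sum_l H k a l.
Proof.
pose G (p : {k : 'I_m & 'I_(r k * s k)}) :=
  H (tag p) (mxtens_unindex (tagged p)).1 (mxtens_unindex (tagged p)).2.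
transitivity (\sum_(t < \sum_(k < m) r k * s k) G (tagnat.sig t)).
  by apply: eq_bigr => t _; rewrite tagnat.sigE12.
rewrite (reindex (@tagnat.rank _ _)) /=; last first.
  by exists (@tagnat.sig _ _) => x _; [apply: tagnat.rankK | apply: tagnat.sigK].
under eq_bigr => p _ do rewrite tagnat.rankK.
transitivity (\sum_(k < m) \sum_(x < r k * s k)
    H k (mxtens_unindex x).1 (mxtens_unindex x).2).
  by rewrite [RHS]sig_big_dep.
apply: eq_bigr => k _; rewrite [RHS]pair_big.
rewrite [LHS](reindex (@mxtens_index _ _)); last first.
  exists (@mxtens_unindex _ _) => x _;
    [exact: mxtens_indexK | exact: mxtens_unindexK].
by apply: eq_bigr => -[a l] _; rewrite mxtens_indexK.
Qed.

End Blocks.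

Section Independence.
Variables (F : finFieldType) (n : nat) (R : realType).
Local Notation space := {vspace 'rV[F]_n}.

(** By induction on [k].  Summing the relation on level [i] over the [V] above
[X], with [\dim X = k], leaves from each [k'] the multiple [up_coef k' k i] of
the lift at [X]: this is zero for [k' < k] by induction and for [k' > k]
because [X] is too small.  For [k' = k] the lift at [X] is the value of [f]
there, and its coefficient is nonzero. *)
Lemma lifts_independent (n_gt1 : (1 < n)%N)
    (f : forall k : 'I_n./2.+1, 'I_(Ltilde_size n k) -> space -> R) :
  (forall (k : 'I_n./2.+1) l, harmonic k (f k l)) ->
  \sum_(k < n./2.+1) \sum_(l < Ltilde_size n k)
    level_cochain (base_level k + l)%N (lift k (f k l)) = 0 ->
  forall (k : 'I_n./2.+1) l X, \dim X = k -> f k l X = 0.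
Proof.
move=> hf sum0 k; have [m] := ubnP (k : nat); elim: m k => // m IH k lt_km l X dX.
have le_half (k' : 'I_n./2.+1) : (k' <= n./2)%N by rewrite -ltnS.
have [i_bounds i_range] := level_bounds l n_gt1 (le_half k).
set i := (base_level k + l)%N in i_bounds i_range.
(* The value on level [i] of the relation, extended to all subspaces. *)
pose Phi (U : space) := \sum_(k' < n./2.+1) \sum_(l' < Ltilde_size n k')
   (if i == (base_level k' + l')%N then lift k' (f k' l') U else 0).
have Phi0 (U : vertex F n) : vdim U = i -> Phi (val U) = 0.
  move=> dU; have := congr1 (fun phi : cochain0 F n R => phi U) sum0.
  rewrite sum_ffunE [RHS]ffunE => <-; apply: eq_bigr => k' _; rewrite sum_ffunE.
  by apply: eq_bigr => l' _; rewrite ffunE dU.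
have : \sum_(V | (\dim V == i) && (X <= V)%VS) Phi V = 0.
  rewrite -(sum_vertex_level (fun V => (X <= V)%VS) Phi i_bounds).
  by apply: big1 => V /andP[/eqP dV _]; apply: Phi0.
rewrite exchange_big /=.
rewrite (bigD1 k) //= [X in _ + X]big1 ?addr0; last first.
  move=> k' ne_k'; rewrite exchange_big /= big1 // => l' _.
  case: eqP => _; last by rewrite big1.
  rewrite lift_up //; last by case/andP: i_bounds => _ /ltnW.
  move: ne_k'; rewrite -val_eqE /= => ne_k'.
  case: (ltngtP k' k) ne_k' => // lt _.
    rewrite /lift big1 ?mulr0 // => W /andP[/eqP dW _]; apply: IH => //.
    exact: leq_trans lt _.
  by rewrite lift_low ?mulr0 ?dX.
rewrite exchange_big (bigD1 l) //= [X in _ + X]big1 ?addr0; last first.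
  move=> l' ne_l'; rewrite big1 // => V _.
  by rewrite /i eqn_add2l eq_sym (_ : (l' == l :> nat) = false) //; apply/negbTE.
rewrite eqxx lift_up //; last by case/andP: i_bounds => _ /ltnW.
rewrite lift_self // dX => /eqP; rewrite mulf_eq0 (negbTE (up_coef_neq0 F R _ _)) //=.
- by move/eqP.
- by case/andP: i_range.
- by case/andP: i_range; lia.
Qed.

End Independence.

Theorem theorem1p7 (R : realType) (F : finFieldType) (n : nat) (hn : (3 <= n)%N) :
  exists B : (\sum_(k < (n./2).+1) multiplicity F n k * Ltilde_size n k)%N
               .-tuple (cochain0 F n R),
    basis_of fullv B /\
    matrix_rep B (@upper_laplacian0 F n R) =
      \mxdiag_(k < (n./2).+1) Lblock R F n k.
Proof.
have n_gt1 : (1 < n)%N by exact: ltnW.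
pose h k := projT1 (cid (harmonic_family F n R k)).
have hP k : (forall a, harmonic k (h k a)) /\
    (forall c : 'I_(multiplicity F n k) -> R,
       (forall W, \dim W = k -> \sum_a c a * h k a W = 0) -> forall a, c a = 0).
  exact: projT2 (cid (harmonic_family F n R k)).
pose b k a l : cochain0 F n R := level_cochain (base_level k + l)%N (lift k (h k a)).
pose N := (\sum_(k < (n./2).+1) multiplicity F n k * Ltilde_size n k)%N.
pose Bfun (t : 'I_N) : cochain0 F n R :=
  b (tagnat.sig1 t : nat) (mxtens_unindex (tagnat.sig2 t)).1
    (mxtens_unindex (tagnat.sig2 t)).2.
pose B : N.-tuple (cochain0 F n R) := [tuple Bfun t | t < N].
have BE (t : 'I_N) : B`_t = Bfun t by rewrite -tnth_nth tnth_mktuple.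
have freeB : free B.
  apply/freeP => c.
  (* The coefficients reindexed by block, copy and level. *)
  pose C (k : 'I_(n./2).+1) a l := c (tagnat.Rank k (mxtens_index (a, l))).
  have cE t : c t = C (tagnat.sig1 t) (mxtens_unindex (tagnat.sig2 t)).1
                      (mxtens_unindex (tagnat.sig2 t)).2.
    by rewrite /C -surjective_pairing mxtens_unindexK tagnat.sig2K.
  under eq_bigr => t _ do rewrite BE cE.
  rewrite (sum_block_index (r := multiplicity F n) (s := Ltilde_size n)
    (fun k a l => C k a l *: b k a l)) => sum0 t; rewrite cE.
  pose f (k : 'I_(n./2).+1) l W := \sum_a C k a l * h k a W.
  have hf (k : 'I_(n./2).+1) l : harmonic k (f k l).
    by apply: harmonic_sum; case: (hP k).
  have f0 : \sum_(k < (n./2).+1) \sum_(l < Ltilde_size n k)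
      level_cochain (base_level k + l)%N (lift k (f k l)) = 0.
    rewrite -[RHS]sum0; apply: eq_bigr => k _; rewrite exchange_big /=.
    apply: eq_bigr => l _; apply/ffunP => U; rewrite sum_ffunE ffunE.
    under eq_bigr => a _ do rewrite !ffunE.
    case: ifP => _; first by rewrite lift_sum.
    by rewrite big1 // => a _; rewrite scaler0.
  move: (tagnat.sig1 t) (mxtens_unindex _).1 (mxtens_unindex _).2 => k a l.
  have [_ indep] := hP k; move: a; apply: indep => W dW.
  exact: (lifts_independent n_gt1 hf f0).
exists B; split.
  rewrite basisEfree freeB subvf size_tuple dim_cochain0 ?(ltnW n_gt1) //=.
  by apply: sum_gauss_le; apply: ltnW.
apply/matrixP => s t; rewrite mxE tnth_mktuple.
suff -> : upper_laplacian0 F n R (Bfun t) =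
    \sum_s (\mxdiag_(k < (n./2).+1) Lblock R F n k) s t *: B`_s.
  by rewrite (coord_sum_free _ _ freeB).
set k0 := tagnat.sig1 t; set x0 := tagnat.sig2 t.
have le_k0 : (k0 <= n./2)%N by rewrite -ltnS.
have [hh _] := hP k0.
rewrite {1}/Bfun /b (laplacian_level_lift _ n_gt1 le_k0 (hh _)) -/k0 -/x0.
pose p_ k := (multiplicity F n k * Ltilde_size n k)%N.
pose H (k : 'I_(n./2).+1) a l : cochain0 F n R :=
  (if k == k0 then conform_mx (0 : 'M[R]_(p_ k, p_ k0)) (Lblock R F n k) else 0)
    (mxtens_index (a, l)) x0 *: b k a l.
transitivity (\sum_k \sum_a \sum_l H k a l); last first.
  rewrite -(sum_block_index (r := multiplicity F n) (s := Ltilde_size n) H).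
  apply: eq_bigr => u _; rewrite BE mxE /H -surjective_pairing mxtens_unindexK.
  by [].
rewrite (bigD1 k0) //= [X in _ + X]big1 ?addr0 => [|k ne_k]; last first.
  by apply: big1 => a _; apply: big1 => l _; rewrite /H (negbTE ne_k) mxE scale0r.
have HE a l : H k0 a l =
    ((a == (mxtens_unindex x0).1)%:R * Ltilde R F n k0 l (mxtens_unindex x0).2)
      *: b k0 a l.
  rewrite /H eqxx conform_mx_id -{1}(mxtens_unindexK x0).
  rewrite [mxtens_unindex x0]surjective_pairing.
  by rewrite /Lblock tensmxE mxE.
rewrite (bigD1 (mxtens_unindex x0).1) //= [X in _ + X]big1 ?addr0 => [|a ne_a].
  by apply: eq_bigr => l _; rewrite HE eqxx mul1r.
by apply: big1 => l _; rewrite HE (negbTE ne_a) mul0r scale0r.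
Qed.
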